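(* Let $X$ be a Banach space over the real or complex field $\mathbb{F}$ and let $\mathcal{B}(X)$ be the algebra of all bounded linear operators on $X$. Then every Lie isomorphism $\mathfrak{l}\colon\mathcal{B}(X)\to\mathcal{B}(X)$ has the standard form: $\mathfrak{l}=\mathfrak{m}+\mathfrak{n}$, where $\mathfrak{m}\colon\mathcal{B}(X)\to\mathcal{B}(X)$ is an isomorphism or the negative of an anti-isomorphism of $\mathbb{F}$-algebras, and $\mathfrak{n}\colon\mathcal{B}(X)\to\mathcal{Z}(\mathcal{B}(X))$ is an $\mathbb{F}$-linear mapping with $\mathfrak{n}([a,b])=0$ for all $a,b\in\mathcal{B}(X)$.
   Context: $\mathcal{Z}(\cdot)$ denotes the center and $[a,b]=ab-ba$. A Lie isomorphism is an $\mathbb{F}$-linear bijection $\mathfrak{l}$ with $\mathfrak{l}([a,b])=[\mathfrak{l}(a),\mathfrak{l}(b)]$ for all $a,b$. No continuity is assumed of the mappings. *)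

(* Defs.v *)
From HB Require Import structures.
From mathcomp Require Import all_boot all_order all_algebra.
From mathcomp Require Import all_classical all_reals topology normedtype.
From mathcomp Require Import complex.

Set Implicit Arguments.
Unset Strict Implicit.
Unset Printing Implicit Defensive.

Import Order.TTheory GRing.Theory Num.Theory.
Import numFieldNormedType.Exports.

Local Open Scope ring_scope.

Section BoundedOperators.
Context {K : numFieldType} (X : completeNormedModType K).

Definition bounded_operator (f : X -> X) : Prop :=
  linear f /\ exists M : K, forall x, `|f x| <= M * `|x|.

Definition bounded_operators : {pred X -> X} :=
  fun f => `[< bounded_operator f >].

Record boundedOp := BoundedOp {
  boundedOp_fun :> X -> X;
  boundedOpP : boundedOp_fun \in bounded_operators
}.

HB.instance Definition _ := [isSub for boundedOp_fun].
HB.instance Definition _ := [Choice of boundedOp by <:].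

Fact bounded_operators_submod_closed : submod_closed bounded_operators.
Proof.
split; first by apply/asboolP; split;
  [move=> a u v /=; rewrite scaler0 addr0|
   exists 0 => x; rewrite normr0 mul0r].
move=> a f g /asboolP[lf [M fM]] /asboolP[lg [N gN]]; apply/asboolP; split.
  move=> b u v; rewrite !fctE /= lf lg !scalerDr !scalerA (mulrC b a).
  by rewrite addrACA.
exists (`|a| * M + N) => x; rewrite !fctE /= mulrDl.
apply: le_trans (ler_normD _ _) _; rewrite lerD //.
by rewrite normrZ -mulrA ler_wpM2l.
Qed.

HB.instance Definition _ :=
  GRing.isSubmodClosed.Build K (X -> X) bounded_operators
    bounded_operators_submod_closed.
HB.instance Definition _ := [SubChoice_isSubLmodule of boundedOp by <:].

Fact boundedOp_id_subproof : idfun \in bounded_operators.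
Proof. by apply/asboolP; split=> //; exists 1 => x; rewrite mul1r. Qed.

Fact boundedOp_comp_subproof (f g : boundedOp) : f \o g \in bounded_operators.
Proof.
have /asboolP[lf [M fM]] := boundedOpP f.
have /asboolP[lg [N gN]] := boundedOpP g.
apply/asboolP; split; first by move=> a u v /=; rewrite lg lf.
have [[x xN0]|X0] := pselect (exists x : X, x != 0); last first.
  exists 0 => x /=.
  have x0 (y : X) : y = 0.
    by apply: contrapT => /eqP yN0; apply: X0; exists y.
  by rewrite (x0 (f _)) normr0 mul0r.
have M0 : 0 <= M.
  by rewrite -(pmulr_lge0 _ (_ : 0 < `|x|)) ?normr_gt0 // (le_trans _ (fM x)).
exists (M * N) => y /=; apply: le_trans (fM _) _.
by rewrite -mulrA ler_wpM2l.
Qed.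

Definition boundedOp_one := BoundedOp boundedOp_id_subproof.
Definition boundedOp_mul (f g : boundedOp) :=
  BoundedOp (boundedOp_comp_subproof f g).

Lemma boundedOp_linear (f : boundedOp) : linear f.
Proof. by have /asboolP[] := boundedOpP f. Qed.

Lemma boundedOp_ext (f g : boundedOp) : f =1 g -> f = g.
Proof. by move=> fg; apply: val_inj; apply/funext. Qed.

Lemma boundedOp_addE (f g : boundedOp) x : (f + g) x = f x + g x.
Proof. by []. Qed.

Lemma boundedOp_oppE (f : boundedOp) x : (- f) x = - f x.
Proof. by []. Qed.

Lemma boundedOp_scaleE a (f : boundedOp) x : (a *: f) x = a *: f x.
Proof. by []. Qed.

Fact boundedOp_mulA : associative boundedOp_mul.
Proof. by move=> f g h; apply: boundedOp_ext. Qed.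

Fact boundedOp_mul1l : left_id boundedOp_one boundedOp_mul.
Proof. by move=> f; apply: boundedOp_ext. Qed.

Fact boundedOp_mul1r : right_id boundedOp_one boundedOp_mul.
Proof. by move=> f; apply: boundedOp_ext. Qed.

Fact boundedOp_mulDl : left_distributive boundedOp_mul +%R.
Proof. by move=> f g h; apply: boundedOp_ext. Qed.

Fact boundedOp_mulDr : right_distributive boundedOp_mul +%R.
Proof.
move=> f g h; apply: boundedOp_ext => x.
have := boundedOp_linear f 1 (g x) (h x).
by rewrite !scale1r.
Qed.

(* Only a pzRingType: MathComp algebras are nontrivial rings, and the space
   X = 0, whose operator algebra is zero, is not excluded. *)
HB.instance Definition _ := GRing.Zmodule_isPzRing.Build boundedOp
  boundedOp_mulA boundedOp_mul1l boundedOp_mul1r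
  boundedOp_mulDl boundedOp_mulDr.

Lemma boundedOp_mulE (f g : boundedOp) x : (f * g) x = f (g x).
Proof. by []. Qed.

Lemma boundedOp_oneE x : (1 : boundedOp) x = x.
Proof. by []. Qed.

Lemma boundedOp_scaleAl a (f g : boundedOp) : a *: (f * g) = (a *: f) * g.
Proof. by apply: boundedOp_ext. Qed.

Lemma boundedOp_scaleAr a (f g : boundedOp) : a *: (f * g) = f * (a *: g).
Proof.
apply: boundedOp_ext => x.
rewrite boundedOp_scaleE !boundedOp_mulE boundedOp_scaleE.
have lf := boundedOp_linear f.
have f0 : f 0 = 0.
  by have := lf (-1) 0 0; rewrite scaler0 addr0 scaleN1r addNr.
by have := lf a (g x) 0; rewrite f0 !addr0 => ->.
Qed.

End BoundedOperators.

Notation "''B' ( X )" := (boundedOp X) (at level 8, format "''B' ( X )").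

Definition lie_bracket (A : pzRingType) (a b : A) : A := a * b - b * a.

Definition ring_center (A : pzRingType) : set A :=
  [set z | forall a, z * a = a * z]%classic.
Arguments ring_center A : clear implicits.

Section OperatorAlgebraMaps.
Context {K : numFieldType} {X : completeNormedModType K}.
Implicit Type f : 'B(X) -> 'B(X).

Definition lie_isomorphism f : Prop :=
  [/\ linear f, bijective f
    & forall a b, f (lie_bracket a b) = lie_bracket (f a) (f b)].

Definition algebra_isomorphism f : Prop :=
  [/\ linear f, bijective f & monoid_morphism f].

Definition algebra_antiisomorphism f : Prop :=
  [/\ linear f, bijective f & monoid_morphism (f : 'B(X) -> 'B(X)^c)].

End OperatorAlgebraMaps.

Variant real_or_complex : numFieldType -> Prop :=
| RealScalars (R : realType) : real_or_complex R
| ComplexScalars (R : realType) : real_or_complex R[i].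

(* Main.v *)
(* Call [a] extremal if [a^2 = 0] and [a b a] is a multiple [t(b) a] of [a] for
   every [b]; by Hahn-Banach these are the square-zero operators of rank at most
   one. As [[a,[a,b]] = -2 a b a] for them, a Lie isomorphism [l] preserves
   extremality together with the form [t].

   Fix a rank-one idempotent [e = x0 (x) f0]. The elements of [(1-e)Be] share the
   functional [f0] and those of [eB(1-e)] share the vector [x0]; both are linear
   spaces of extremal elements, so each of their images shares a functional or a
   vector. As [t] pairs the two spaces without degeneracy, the images keep these
   two roles or exchange them. The second case becomes the first one on replacing
   the domain by its opposite ring and [l] by [-l].

   In the first case [l] on [(1-e)Be] defines a linear map [U : Be -> X] with
   [l(c) U = U c] for [c] in [(1-e)Be] and [eB(1-e)], hence for all [c] of finite
   rank and trace zero. Bracketing an arbitrary [b] with nilpotent [c] of rank one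
   shows that [l(b) U - U b] is pointwise, hence globally, a multiple [n(b)] of
   [U]. So [b |-> l(b) - n(b)] is implemented by [U] and is multiplicative. *)
Require Import Defs.
From HB Require Import structures.
From mathcomp Require Import all_boot all_order all_algebra.
From mathcomp Require Import all_classical all_reals topology normedtype.
From mathcomp Require Import complex ring lra.
Import Order.TTheory GRing.Theory Num.Theory.
Local Open Scope ring_scope.

Set Implicit Arguments.
Unset Strict Implicit.
Unset Printing Implicit Defensive.

(** * The Hahn-Banach theorem *)

(** Positive homogeneity is asked as an inequality; its instance for [r^-1] gives the reverse
    one. *)
Definition sublinear (R : realType) (V : lmodType R) (q : V -> R) : Prop :=
  (forall x y, q (x + y) <= q x + q y) /\
  (forall r x, 0 < r -> q (r *: x) <= r * q x).

Lemma sublinear_ge (R : realType) (V : lmodType R) (q : V -> R) x :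
  sublinear q -> - q (- x) <= q x.
Proof.
move=> [qD _]; have := qD x (- x); have := qD 0 0; rewrite addr0 subrr.
by move=> h1 h2; lra.
Qed.

(* The largest sublinear functional below [q] with value at most [- q y]
   at [- y]. *)
Definition sublinear_shift (R : realType) (V : lmodType R) (q : V -> R) (y : V)
    (x : V) : R :=
  inf [set s | exists2 t, 0 <= t & s = q (x + t *: y) - t * q y]%classic.

Section SublinearShift.
Context (R : realType) (V : lmodType R) (q : V -> R) (y : V).
Hypothesis q_sub : sublinear q.

Lemma sublinear_shift_le x t :
  0 <= t -> sublinear_shift q y x <= q (x + t *: y) - t * q y.
Proof.
move=> t0; apply: ge_inf; last by exists t.
(* The lower bound comes from [s * q y <= q (s *: y) <= q (x + s *: y) + q (- x)]. *)
exists (- q (- x)) => _ [s s0 ->].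
have [qD qZ] := q_sub.
have [s_gt0|s_lt0|<-] := ltgtP 0 s; last first.
- by rewrite scale0r addr0 mul0r subr0 sublinear_ge.
- by move: s0; rewrite leNgt s_lt0.
have := qD (x + s *: y) (- x); rewrite addrAC subrr add0r.
have := qZ _ y s_gt0.
(* [s * q y <= q (s *: y)] by scaling back with [s^-1] *)
have := qZ s^-1 (s *: y); rewrite invr_gt0 s_gt0 scalerA mulVf ?gt_eqF// scale1r.
move=> /(_ isT); rewrite ler_pdivlMl// => h1 h2 h3; lra.
Qed.

Lemma sublinear_shift_ge x m :
  (forall t, 0 <= t -> m <= q (x + t *: y) - t * q y) ->
  m <= sublinear_shift q y x.
Proof.
move=> h; apply: lb_le_inf; first by exists (q (x + 0 *: y) - 0 * q y), 0.
by move=> _ [t t0 ->]; apply: h.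
Qed.

Lemma sublinear_shift_sublinear : sublinear (sublinear_shift q y).
Proof.
have [qD qZ] := q_sub; split=> [x z|r x r0].
  rewrite -lerBlDr; apply: sublinear_shift_ge => t t0.
  rewrite lerBlDr -lerBlDl; apply: sublinear_shift_ge => s s0.
  rewrite lerBlDl; apply: le_trans (sublinear_shift_le _ (addr_ge0 t0 s0)) _.
  have := qD (x + t *: y) (z + s *: y).
  by rewrite addrACA -scalerDl mulrDl => ?; lra.
rewrite -ler_pdivrMl//; apply: sublinear_shift_ge => t t0.
rewrite ler_pdivrMl//.
apply: le_trans (sublinear_shift_le _ (mulr_ge0 (ltW r0) t0)) _.
have := qZ r (x + t *: y) r0; rewrite scalerDr scalerA => ?; lra.
Qed.

Lemma sublinear_shift_le_self x : sublinear_shift q y x <= q x.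
Proof.
by have := sublinear_shift_le x (lexx 0); rewrite scale0r addr0 mul0r subr0.
Qed.

End SublinearShift.

Section HahnBanach.
Context (R : realType) (V : lmodType R).

(** Provides the bounds of chains for Zorn's lemma. The pointwise infimum is finite because every
    member is at least [- p (- x)] at [x]. It is subadditive because, of two members of the chain,
    the smaller one can serve at both arguments. *)
Lemma sublinear_inf (C : set (V -> R)) (p : V -> R) :
  (C !=set0)%classic -> (forall q, C q -> sublinear q /\ forall x, q x <= p x) ->
  (forall q r, C q -> C r ->
     (forall x, q x <= r x) \/ (forall x, r x <= q x)) ->
  exists q0, sublinear q0 /\ forall q, C q -> forall x, q0 x <= q x.
Proof.
move=> [c Cc] Cp Ctot; pose S x := [set s | exists2 q, C q & s = q x]%classic.
have Slb x : has_lbound (S x).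
  exists (- p (- x)) => _ [q Cq ->]; have [qs qp] := Cp _ Cq.
  by apply: le_trans (sublinear_ge x qs); rewrite lerN2.
have S0 x : (S x !=set0)%classic by exists (c x), c.
exists (fun x => inf (S x)); split; last first.
  by move=> q Cq x; apply: ge_inf => //; exists q.
split=> [x y|r x r0].
  rewrite -lerBlDr; apply: lb_le_inf => // _ [q Cq ->].
  rewrite lerBlDr -lerBlDl; apply: lb_le_inf => // _ [q' Cq' ->].
  rewrite lerBlDl.
  have H q1 : C q1 -> inf (S (x + y)) <= q1 x + q1 y.
    move=> Cq1; apply: le_trans (ge_inf (Slb _) _) _; first by exists q1.
    by have [[qD _] _] := Cp _ Cq1.
  by case: (Ctot _ _ Cq Cq') => h;
    [apply: le_trans (H _ Cq) _|apply: le_trans (H _ Cq') _]; rewrite lerD.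
rewrite -ler_pdivrMl//; apply: lb_le_inf => // _ [q Cq ->].
rewrite ler_pdivrMl//; apply: le_trans (ge_inf (Slb _) _) _; first by exists q.
by have [[_ qZ] _] := Cp _ Cq; apply: qZ.
Qed.

Lemma minimal_sublinear (p : V -> R) : sublinear p ->
  exists q, [/\ sublinear q, forall x, q x <= p x
    & forall r, sublinear r -> (forall x, r x <= q x) -> r = q].
Proof.
move=> ps; pose T := {q : V -> R | sublinear q /\ forall x, q x <= p x}.
(* The order is reversed: a maximal element for [le] is a minimal functional. *)
pose le (q r : T) := `[< forall x, sval r x <= sval q x >].
have [||||[q [qs qp]] qmin] := @Zorn T le.
- by move=> t; apply/asboolP.
- move=> r s t /asboolP rs /asboolP st; apply/asboolP => x.
  exact: le_trans (st x) (rs x).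
- move=> [s Ps] [t Pt] /asboolP/= st /asboolP/= ts; apply: eq_exist.
  by apply/funext => x; apply/eqP; rewrite eq_le st ts.
- move=> A Atot; have [[a Aa]|A0] := pselect (A !=set0)%classic; last first.
    by exists (exist _ p (conj ps (fun x => lexx _))) => s As; case: A0; exists s.
  have [|||q0 [q0s q0A]] := @sublinear_inf (sval @` A)%classic p.
  + by exists (sval a), a.
  + by move=> _ [q Aq <-]; apply: svalP q.
  + by move=> _ _ [q Aq <-] [r Ar <-]; case: (Atot _ _ Aq Ar) => /asboolP; tauto.
  have q0p x : q0 x <= p x.
    by apply: le_trans (q0A _ _ x) _; [exists a|exact: (svalP a).2].
  exists (exist _ q0 (conj q0s q0p)) => s As; apply/asboolP => x /=.
  by apply: q0A; exists s.
exists q; split=> // r rs rq.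
have rp x : r x <= p x := le_trans (rq x) (qp x).
have /asboolP := rq => /(qmin (exist _ r (conj rs rp))).
by move/(congr1 sval).
Qed.

(* Minimality forces [sublinear_shift q y = q] for every [y], which says that
   [q] is superadditive as well. *)
Lemma hahn_banach (p : V -> R) (x0 : V) : sublinear p ->
  exists f : V -> R, [/\ scalar f, forall x, f x <= p x & p x0 <= f x0].
Proof.
(* Minimizing below the shift of [p] along [x0], instead of below [p], forces
   [q (- x0) <= - p x0]. *)
move=> ps; have p0s := sublinear_shift_sublinear x0 ps.
have [q [qs qp qmin]] := minimal_sublinear p0s.
have [qD qZ] := qs.
have q0 : q 0 = 0.
  apply/eqP; rewrite eq_le; apply/andP; split.
    by have := qZ 2^-1 0; rewrite scaler0 invr_gt0 ltr0n => /(_ isT) ?; lra.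
  by have := qD 0 0; rewrite addr0 => ?; lra.
(* Superadditivity: [q x = sublinear_shift q y x <= q (x + y) - q y], with parameter [1]. *)
have add x y : q (x + y) = q x + q y.
  apply/eqP; rewrite eq_le qD/=.
  have /(congr1 (@^~ x)) /= <- := qmin _ (sublinear_shift_sublinear y qs)
    (sublinear_shift_le_self y qs).
  by have := sublinear_shift_le y qs x ler01; rewrite scale1r mul1r lerBrDr.
have opp x : q (- x) = - q x.
  by apply/eqP; rewrite -addr_eq0 -add addrC subrr q0.
have pos r x : 0 < r -> q (r *: x) = r * q x.
  move=> r0; apply/eqP; rewrite eq_le qZ//=.
  by have := qZ r (- x) r0; rewrite scalerN !opp mulrN lerN2.
exists q; split=> [a x y|x|].
- rewrite add; congr (_ + _); have [a0|a0|<-] := ltgtP 0 a; first exact: pos.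
    by rewrite -[a]opprK scaleNr opp pos ?oppr_gt0// !mulNr.
  by rewrite scale0r q0 mul0r.
- exact: le_trans (qp x) (sublinear_shift_le_self x0 ps x).
- rewrite -lerN2 -opp; apply: le_trans (qp _) _.
  apply: le_trans (sublinear_shift_le x0 ps _ ler01) _.
  rewrite scale1r mul1r addNr.
  suff : p 0 <= 0 by lra.
  by have := ps.2 2^-1 0; rewrite scaler0 invr_gt0 ltr0n => /(_ isT) ?; lra.
Qed.

End HahnBanach.

(** An alias, so that the real scalar action does not compete with the complex one on [X]. *)
Definition realification (R : realType) (X : lmodType R[i]) : Type := X.

Section Realification.
Context (R : realType) (X : lmodType R[i]).
Implicit Types (a b : R) (x : realification X).
Local Open Scope complex_scope.

HB.instance Definition _ := GRing.Zmodule.on (realification X).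

Let scale a x : realification X := a%:C *: (x : X).

Fact realification_scalerA a b x : scale a (scale b x) = scale (a * b) x.
Proof. by rewrite /scale scalerA rmorphM. Qed.

Fact realification_scale1r : left_id 1 scale.
Proof. by move=> x; rewrite /scale rmorph1 scale1r. Qed.

Fact realification_scalerDr : right_distributive scale +%R.
Proof. by move=> a x y; rewrite /scale scalerDr. Qed.

Fact realification_scalerDl x : {morph scale^~ x : a b / a + b}.
Proof. by move=> a b; rewrite /scale rmorphD scalerDl. Qed.

HB.instance Definition _ := GRing.Zmodule_isLmodule.Build R (realification X)
  realification_scalerA realification_scale1r realification_scalerDr
  realification_scalerDl.

Lemma realification_scaleE a x : a *: x = a%:C *: (x : X) :> X.
Proof. by []. Qed.

End Realification.

(** * Bounded functionals that do not vanish at a given vector *)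

Definition bounded_functional (F : numFieldType) (X : completeNormedModType F)
    (f : X -> F) : Prop :=
  scalar f /\ exists M, forall x, `|f x| <= M * `|x|.

Lemma exists_functional_real (R : realType) (X : completeNormedModType R) x :
  x != 0 -> exists2 f : X -> R, bounded_functional f & f x != 0.
Proof.
move=> x0; have [|f [fl fle fx]] := @hahn_banach R X (fun x => `|x|) x.
  split=> [y z|r y r0]; first exact: ler_normD.
  by rewrite normrZ gtr0_norm.
exists f; last by rewrite gt_eqF// (lt_le_trans _ fx) ?normr_gt0.
split=> //; exists 1 => y; rewrite mul1r ler_norml fle andbT.
have f0 : f 0 = 0 by have := fl (-1) 0 0; rewrite scaler0 addr0 => ?; lra.
have := fl (-1) y 0; have := fle (- y).
by rewrite normrN scaleN1r addr0 f0 => ? ?; lra.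
Qed.

(** The Bohnenblust-Sobczyk argument: a real-linear [f] dominated by the norm is the real part of
    the complex-linear functional [g y = f y - i f (i y)], and [f x] is already nonzero. *)
Lemma exists_functional_complex (R : realType) (X : completeNormedModType R[i])
    x : x != 0 -> exists2 f : X -> R[i], bounded_functional f & f x != 0.
Proof.
(* The norm has values in [R[i]]; they are real, so taking real parts loses nothing. *)
move=> x0; pose p (y : realification X) : R := complex.Re `|y : X|.
have pE (y : X) : (p y)%:C%C = `|y| by apply: RRe_real; apply: normr_real.
have [|f [fl fle fx]] := @hahn_banach R (realification X) p x.
  split=> [y z|r y r0]; rewrite -lecR.
    by rewrite rmorphD /= !pE; apply: (ler_normD (y : X)).
  rewrite rmorphM /= !pE realification_scaleE normrZ gtr0_norm ?pE//.
  by rewrite ltcR.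
have fD y z : f (y + z) = f y + f z by have := fl 1 y z; rewrite scale1r mul1r.
have f0 : f 0 = 0 by have := fD 0 0; rewrite addr0 => ?; lra.
have fZ a y : f (a *: y) = a * f y by have := fl a y 0; rewrite f0 !addr0.
have fN y : f (- y) = - f y by have := fD y (- y); rewrite subrr f0 => ?; lra.
have fb (y : X) : `|f y|%:C%C <= `|y|.
  rewrite -pE lecR ler_norml fle andbT lerNl -fN.
  by apply: le_trans (fle _) _; rewrite /p normrN.
pose g (y : X) : R[i] := (f y)%:C%C - 'i%C * (f ('i%C *: y))%:C%C.
have gE y : g y = Complex (f y) (- f ('i%C *: y)).
  by rewrite /g; apply/eqP; rewrite eq_complex/=; apply/andP; split; apply/eqP;
   ring.
exists g; last first.
  apply/negP; rewrite gE eq_complex/= => /andP[/eqP gx _].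
  have : `|x| <= 0 by rewrite -pE -[0]/(0%:C)%C lecR -gx.
  by rewrite normr_le0 (negPf x0).
split.
  move=> [a b] u v; rewrite !gE scalerDr !fD.
  have hZ c d (y : X) : f (Complex c d *: y) = c * f y + d * f ('i%C *: y).
    rewrite -(fZ c y) -(fZ d ('i%C *: y)) -fD; congr f.
    rewrite !realification_scaleE scalerA.
    apply: etrans (scalerDl (y : X) _ _); congr (_ *: _).
    by apply/eqP; rewrite eq_complex/=; apply/andP; split; apply/eqP; ring.
  have -> : 'i%C *: (Complex a b *: u) = Complex (- b) a *: u.
    rewrite scalerA; congr (_ *: _).
    by apply/eqP; rewrite eq_complex/=; apply/andP; split; apply/eqP; ring.
  rewrite (hZ a b u) (hZ (- b) a u).
  by apply/eqP; rewrite eq_complex/=; apply/andP; split; apply/eqP; ring.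
exists 2 => y; apply: le_trans (ler_normB _ _) _.
have h (r : R) : `|r%:C%C| = `|r|%:C%C :> R[i].
  by rewrite normc_def/= expr0n/= addr0 sqrtr_sqr.
rewrite normrM !h mulr_natl mulr2n lerD ?fb//.
have -> : `|'i%C| = 1 :> R[i] by rewrite normc_def/= expr0n/= expr1n add0r sqrtr1.
rewrite mul1r; apply: le_trans (fb _) _; rewrite normrZ.
by rewrite normc_def/= expr0n/= expr1n add0r sqrtr1 mul1r.
Qed.

Lemma exists_functional (F : numFieldType) (X : completeNormedModType F) :
  real_or_complex F -> forall x : X, x != 0 ->
  exists2 f : X -> F, bounded_functional f & f x = 1.
Proof.
move=> hF x x0.
have [f [fl [M fM]] fx] : exists2 f : X -> F, bounded_functional f & f x != 0.
  case: hF X x x0 => R X x x0.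
    exact: exists_functional_real.
  exact: exists_functional_complex.
exists (fun y => (f x)^-1 * f y); last by rewrite mulVf.
split; first by move=> a u v; rewrite fl mulrDr mulrCA.
by exists (`|(f x)^-1| * M) => y; rewrite normrM -mulrA ler_wpM2l.
Qed.

(** * Extremal operators *)

Section RankOne.
Context (F : numFieldType) (X : completeNormedModType F).
Implicit Types (a b : 'B(X)) (f g : X -> F).

HB.instance Definition _ a :=
  GRing.isLinear.Build F X X *:%R (boundedOp_fun a) (boundedOp_linear a).

Lemma bounded_functional_lin c d f g :
  bounded_functional f -> bounded_functional g ->
  bounded_functional (fun x => c * f x + d * g x).
Proof.
move=> [fl [M fM]] [gl [N gN]]; split.
  by move=> r u v; rewrite fl gl; ring.
exists (`|c| * M + `|d| * N) => x; apply: le_trans (ler_normD _ _) _.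
by rewrite !normrM mulrDl -!mulrA lerD ?ler_wpM2l.
Qed.

Lemma bounded_functional_comp f a :
  bounded_functional f -> bounded_functional (f \o a).
Proof.
move=> [fl [M fM]]; have /asboolP[_ [N aN]] := boundedOpP a.
split; first by move=> r u v /=; rewrite linearP fl.
(* [M] is known to be nonnegative only once some [a x] is nonzero, hence the absolute value. *)
exists (`|M| * N) => x /=; apply: le_trans (fM _) _.
rewrite -mulrA; apply: (@le_trans _ _ (`|M| * `|a x|)); last first.
  by rewrite ler_wpM2l.
have [/normr0P/eqP->|a0] := eqVneq `|a x| 0; first by rewrite normr0 !mulr0.
have ax : 0 < `|a x| by rewrite lt_def a0 /=.
rewrite ler_pM2r// real_ler_norm// ger0_real//.
by rewrite -(pmulr_lge0 _ ax) (le_trans _ (fM (a x))).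
Qed.

Fact rank_one_subproof f (fP : bounded_functional f) (x : X) :
  (fun z => f z *: x) \in @bounded_operators F X.
Proof.
have [fl [M fM]] := fP; apply/asboolP; split.
  by move=> r u v; rewrite fl scalerDl scalerA.
by exists (M * `|x|) => z; rewrite normrZ mulrAC ler_wpM2r.
Qed.

Definition rank_one f (fP : bounded_functional f) (x : X) : 'B(X) :=
  BoundedOp (rank_one_subproof fP x).

Lemma rank_oneE f (fP : bounded_functional f) x z :
  rank_one fP x z = f z *: x.
Proof. by []. Qed.

Lemma functional0 f : scalar f -> f 0 = 0.
Proof. by move=> fl; have := fl (-1) 0 0; rewrite scaler0 addr0 mulN1r addNr. Qed.

Lemma functionalD f x y : scalar f -> f (x + y) = f x + f y.
Proof. by move=> fl; have := fl 1 x y; rewrite scale1r mul1r. Qed.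

Lemma functionalZ f c x : scalar f -> f (c *: x) = c * f x.
Proof. by move=> fl; have := fl c x 0; rewrite functional0// !addr0. Qed.

Lemma boundedOp_neq0 a : a != 0 -> exists x, a x != 0.
Proof.
move=> a0; apply: contrapT => h; move/eqP: a0; apply; apply: boundedOp_ext => x.
by apply: contrapT => /eqP ax; apply: h; exists x.
Qed.

End RankOne.

Section Extremal.
Context (F : numFieldType) (hF : real_or_complex F).
Context (X : completeNormedModType F).
Implicit Types (a b c : 'B(X)) (t : 'B(X) -> F).

Definition extremal a t := a * a = 0 /\ forall b, a * b * a = t b *: a.

(** If [f (a z) = 1], then [b] = z (x) f satisfies [a b a z = a z], which is nonzero. *)
Lemma extremal_neq0 a t : extremal a t -> a != 0 -> exists b, t b != 0.
Proof.
move=> [_ at_] /boundedOp_neq0[z az].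
have [f fP faz] := exists_functional hF az.
exists (rank_one fP z); apply: contraNneq az => t0.
have := congr1 (fun b : 'B(X) => b z) (at_ (rank_one fP z)).
by rewrite !boundedOp_mulE rank_oneE faz scale1r t0 scale0r => ->.
Qed.

(** With [f (a y) = 1] and [b] = y (x) f, the product [a b a] is the operator (a y) (x) (f o a);
    evaluating at [y] gives [t b = 1], so [a] itself is this operator. *)
Lemma extremal_rank_one a t y : extremal a t -> a y != 0 ->
  exists2 g, bounded_functional g & forall z, a z = g z *: a y.
Proof.
move=> [_ at_] ay; have [f fP fay] := exists_functional hF ay.
have E z := congr1 (fun b : 'B(X) => b z) (at_ (rank_one fP y)).
exists (f \o a); first exact: bounded_functional_comp.
have t1 : t (rank_one fP y) = 1.
  apply/eqP; rewrite -subr_eq0; move: (E y).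
  rewrite !boundedOp_mulE rank_oneE fay boundedOp_scaleE scale1r => /eqP.
  by rewrite -subr_eq0 -{1}[a y]scale1r -scalerBl scaler_eq0 (negPf ay) orbF
    -oppr_eq0 opprB.
move=> z; move: (E z); rewrite !boundedOp_mulE rank_oneE linearZ t1.
by rewrite scale1r => <-.
Qed.

Lemma double_bracketE a b :
  lie_bracket a (lie_bracket a b) = a * a * b - (a * b * a) *+ 2 + b * (a * a).
Proof.
rewrite /lie_bracket mulrBr mulrBl !mulrA mulr2n opprB opprD addrA.
by rewrite [_ - a * b * a + _]addrAC -!addrA; congr (_ + _);
   rewrite addrC -!addrA.
Qed.

(** Since [[a,[a,a c]] = a [a,[a,c]]], a [c0] with [s c0 != 0] makes [a * a] a multiple [k *: a].
    Multiplying the identity for [c] by [a] on the left and on the right then gives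
    [k^2 a c = k^2 c a], so [k = 0] because [a] is not central. What remains of the double bracket
    is [- 2 a c a]. *)
Lemma extremal_of_double_bracket a (s : 'B(X) -> F) :
  (forall c, lie_bracket a (lie_bracket a c) = s c *: a) ->
  (exists c, s c != 0) -> ~ (forall c, a * c = c * a) ->
  extremal a (fun c => - (s c / 2)).
Proof.
move=> as_ [c0 sc0] aNC.
have [k aak] : exists k, a * a = k *: a.
  exists (s (a * c0) / s c0).
  have : s c0 *: (a * a) = s (a * c0) *: a.
    rewrite boundedOp_scaleAr -!as_ !double_bracketE.
    by rewrite mulrDr mulrBr mulrnAr !mulrA.
  by rewrite mulrC -scalerA => <-; rewrite scalerA mulVf// scale1r.
have E c : a * a * c - (a * c * a) *+ 2 + c * (a * a) = s c *: a.
  by rewrite -as_ double_bracketE.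
have [k0|k0] := eqVneq k 0; last first.
  case: aNC => c.
  have L : a * (s c *: a) = (k * k) *: (a * c) - k *: (a * c * a).
    rewrite -E mulrDr mulrBr mulrnAr !mulrA aak.
    rewrite -!boundedOp_scaleAl aak -!boundedOp_scaleAl.
    rewrite -[a * c * a * a]mulrA aak -boundedOp_scaleAr.
    by rewrite mulr2n opprD addrA -!addrA addNr addr0 scalerA.
  have R : (s c *: a) * a = (k * k) *: (c * a) - k *: (a * c * a).
    rewrite -E mulrDl mulrBl mulrnAl aak.
    rewrite -!boundedOp_scaleAl -!boundedOp_scaleAr -!boundedOp_scaleAl.
    rewrite -[a * c * a * a]mulrA -[c * a * a]mulrA aak -!boundedOp_scaleAr.
    by rewrite mulr2n opprD addrA subrr add0r addrC scalerA.
  have : (k * k) *: (a * c) = (k * k) *: (c * a).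
    apply: (addIr (- (k *: (a * c * a)))).
    by rewrite -L -R -boundedOp_scaleAl -boundedOp_scaleAr.
  by move/(scalerI (mulf_neq0 k0 k0)).
have aa : a * a = 0 by rewrite aak k0 scale0r.
split=> // c; have := E c; rewrite aa mulr0 mul0r sub0r addr0 => acE.
rewrite scaleNr mulrC -scalerA -acE scalerN opprK -[in RHS]scaler_nat scalerA.
by rewrite mulVf ?scale1r// pnatr_eq0.
Qed.

End Extremal.

(** * Extremal operators under a Lie isomorphism *)

Section LieExtremal.
Context (F : numFieldType) (hF : real_or_complex F).
Context (X : completeNormedModType F).
Implicit Types (a b c : 'B(X)) (t : 'B(X) -> F).

(** The identity [[a,[a,c]] = - 2 t(c) a] is transported by [l]. The image of [a != 0] is not
    central: otherwise [a] would be central and [a c a = a a c = 0] for all [c], against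
    [extremal_neq0]. *)
Lemma extremal_lie (l : {linear 'B(X) -> 'B(X)}) a t :
  bijective l ->
  (forall a b, l (lie_bracket a b) = lie_bracket (l a) (l b)) ->
  extremal a t ->
  l a * l a = 0 /\ forall b, l a * l b * l a = t b *: l a.
Proof.
move=> [g lK gK] lB at_.
have [->|a0] := eqVneq a 0.
  by rewrite raddf0; split=> [|b]; rewrite ?mul0r ?scaler0.
have [c0 tc0] := extremal_neq0 hF at_ a0.
have [aa aca] := at_.
have dbl c : lie_bracket a (lie_bracket a c) = (- (t c *+ 2)) *: a.
  rewrite double_bracketE aa mulr0 mul0r sub0r addr0 aca.
  by rewrite scaleNr -scalerMnl.
have [|||la2 laca] := @extremal_of_double_bracket F X (l a)
    (fun c => - (t (g c) *+ 2)).
- by move=> c; rewrite -[in LHS](gK c) -!lB dbl linearZ.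
- by exists (l c0); rewrite lK oppr_eq0 mulrn_eq0.
- move=> laC; have aC c : a * c = c * a.
    apply/eqP; rewrite -subr_eq0 -[_ - _]/(lie_bracket a c).
    apply/eqP/(can_inj lK); rewrite raddf0 lB.
    by apply/eqP; rewrite subr_eq0 laC.
  move/eqP: a0; apply; apply/eqP.
  have := aca c0; rewrite -mulrA -aC mulrA aa mul0r => /esym/eqP.
  by rewrite scaler_eq0 (negPf tc0).
split=> // b; rewrite laca lK; congr (_ *: _).
by field.
Qed.

(* Each [s] satisfies one of the alternatives, and the sum of an [s] satisfying
   only the first and an [s'] satisfying only the second would satisfy neither. *)
Lemma rank_le1_dichotomy (M : 'B(X) -> Prop) (s0 : 'B(X)) (g0 : X -> F) (y0 : X) :
  (forall s s', M s -> M s' -> M (s + s')) ->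
  (forall s, M s -> forall z, s z != 0 -> exists g, forall x, s x = g x *: s z) ->
  M s0 -> s0 y0 != 0 -> scalar g0 -> (forall z, s0 z = g0 z *: s0 y0) ->
  (forall s, M s -> forall z, s z = g0 z *: s y0) \/
  (forall s, M s -> forall z, exists k, s z = k *: s0 y0).
Proof.
move=> MD Mr M0 sy0 g0l s0E.
have g0y0 : g0 y0 = 1.
  apply/eqP; rewrite -subr_eq0; have := s0E y0 => /eqP.
  rewrite -subr_eq0 -{1}[s0 y0]scale1r -scalerBl scaler_eq0 (negPf sy0) orbF.
  by rewrite -oppr_eq0 opprB.
pose Mf (s : 'B(X)) := forall z, s z = g0 z *: s y0.
pose Mv (s : 'B(X)) := forall z, exists k, s z = k *: s0 y0.
have dich s : M s -> Mf s \/ Mv s.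
  move=> Ms; have [?|/existsNP[z1 z1P]] := pselect (Mv s); [by right|left].
  have sz1 : s z1 != 0.
    by apply/eqP => sz1; apply: z1P; exists 0; rewrite scale0r.
  have [g sE] := Mr _ Ms _ sz1.
  (* If [g0 z = 0] but [s z != 0], then [s + s0] has range spanned by [s z], so [s0 y0] is a nonzero
     multiple of [s z1], against the choice of [z1]. *)
  have ker z : g0 z = 0 -> s z = 0.
    move=> g0z; apply: contrapT => /eqP sz.
    have sz' : (s + s0) z = s z by rewrite boundedOp_addE s0E g0z scale0r addr0.
    have [|h hE] := Mr _ (MD _ _ Ms M0) z; first by rewrite sz'.
    have s0y0 : s0 y0 = (h y0 * g z - g y0) *: s z1.
      rewrite scalerBl -scalerA -!sE -sz' -hE boundedOp_addE.
      by rewrite addrAC subrr add0r.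
    apply: z1P; exists (h y0 * g z - g y0)^-1; rewrite s0y0 scalerA mulVf ?scale1r//.
    by apply: contraNneq sy0 => c0; rewrite s0y0 c0 scale0r.
  move=> z; have := ker (z - g0 z *: y0).
  rewrite -scaleNr functionalD// functionalZ// g0y0 mulr1 subrr => /(_ erefl).
  by rewrite linearD linearZ/= scaleNr => /eqP; rewrite subr_eq0 => /eqP.
have [?|/existsNP[s]] := pselect (forall s, M s -> Mf s); first by left.
move=> /not_implyP[Ms sNf]; right=> s' Ms'.
have sv : Mv s by case: (dich s Ms).
have [s'f|//] := dich _ Ms'.
have [sf|ssv] := dich _ (MD _ _ Ms Ms').
  case: sNf => z; have := sf z; rewrite !boundedOp_addE s'f scalerDr.
  by move/addIr.
move=> z; have [c cE] := ssv z; have [d dE] := sv z.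
exists (c - d); rewrite scalerBl -cE -dE boundedOp_addE.
by rewrite addrAC subrr add0r.
Qed.

End LieExtremal.

(** * A vector space map implementing a Lie isomorphism *)

(** If the factors [d] at [a] and [c] at [a0] differ, the factor at [a + a0] forces
    [U a = s *: U a0]; then [U], hence also [D], vanishes at [a - s a0], so [c] serves for [a] too.
    The scalar action [act] will be multiplication by [k r] in a ring. *)
Lemma proportional_scalar (F : fieldType) (V : zmodType) (W : lmodType F)
    (act : F -> V -> V) (U D : V -> W) :
  {morph U : x y / x + y} -> {morph D : x y / x + y} ->
  (forall r x, U (act r x) = r *: U x) -> (forall r x, D (act r x) = r *: D x) ->
  (forall a, exists r, D a = r *: U a) -> exists r, forall a, D a = r *: U a.
Proof.
move=> UD DD UZ DZ DU.
have [[a0 Ua0]|U0] := pselect (exists a, U a != 0); last first.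
  exists 0 => a; have [r ->] := DU a.
  by have -> : U a = 0; [apply: contrapT => /eqP ?; apply: U0; exists a|
                         rewrite !scaler0].
have [c Da0] := DU a0; exists c => a.
have [d Da] := DU a; have [r Daa0] := DU (a + a0).
have [dc|dc] := eqVneq d c; first by rewrite Da dc.
have E : (d - r) *: U a = (r - c) *: U a0.
  rewrite !scalerBl -Da -Da0; apply/eqP.
  by rewrite subr_eq addrAC eq_sym subr_eq -scalerDr addrC -UD -Daa0 -DD addrC.
have rd : r != d.
  apply: contraNneq dc => rd; move: E; rewrite rd subrr scale0r => /esym/eqP.
  by rewrite scaler_eq0 (negPf Ua0) orbF subr_eq0.
have Uaa0 : U a = ((d - r)^-1 * (r - c)) *: U a0.
  by rewrite -scalerA -E scalerA mulVf ?scale1r// subr_eq0 eq_sym.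
set s := _ * _ in Uaa0.
have [t Dt] := DU (a + act (- s) a0).
have : D (a + act (- s) a0) = 0.
  by rewrite Dt UD UZ Uaa0 scaleNr subrr scaler0.
rewrite DD DZ Da0 scaleNr => /eqP; rewrite subr_eq0 => /eqP ->.
by rewrite Uaa0 !scalerA mulrC.
Qed.

(* [S] is ['B(X)], or the opposite ring with minus the Lie isomorphism as [l];
   [k] embeds the scalars into [S]. *)
Section Implementation.
Context (F : numFieldType) (hF : real_or_complex F).
Context (X : completeNormedModType F).
Context (S : pzRingType) (k : {rmorphism F -> S}) (e : S) (tau : S -> F).
Context (l : S -> 'B(X)) (y0 : X) (g0 : X -> F).
Implicit Types (a b c u v : S).

Hypothesis kC : forall r a, k r * a = a * k r.
Hypothesis ee : e * e = e.
Hypothesis eaeE : forall a, e * a * e = k (tau a) * e.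
Hypothesis tauD : forall a b, tau (a + b) = tau a + tau b.
Hypothesis tauZ : forall r a, tau (k r * a) = r * tau a.
Hypothesis tau_el : forall a, tau (e * a) = tau a.
Hypothesis tau_er : forall a, tau (a * e) = tau a.
Hypothesis tau_e : tau e = 1.

Hypothesis lD : forall a b, l (a + b) = l a + l b.
Hypothesis lZ : forall r a, l (k r * a) = r *: l a.
Hypothesis l_inj : forall a, l a = 0 -> a = 0.
Hypothesis l_surj : forall y : 'B(X), exists a, l a = y.
Hypothesis lB : forall a b, l (a * b - b * a) = l a * l b - l b * l a.
Hypothesis l_extremal : forall a (t : S -> F),
  a * a = 0 -> (forall b, a * b * a = k (t b) * a) ->
  l a * l a = 0 /\ forall b, l a * l b * l a = t b *: l a.

Hypothesis g0P : bounded_functional g0.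
Hypothesis g0y0 : g0 y0 = 1.
Hypothesis l_col : forall u, u * e = u -> e * u = 0 ->
  forall z, l u z = g0 z *: l u y0.
Hypothesis l_row : forall v, e * v = v -> v * e = 0 ->
  forall z, exists r, l v z = r *: y0.

(** Supplies, for given [a], a row [c] such that [a * c] squares to zero while
    [a * c * z * e = a * e]. *)
Hypothesis tau_split : forall a,
  exists c z, [/\ e * c = c, tau (c * a) = 0 & tau (c * z) = 1].
Hypothesis faithful_e : forall b, (forall a, b * a * e = 0) -> b = 0.

(** By [eaeE], [col a] and [row a] are the Peirce components [(1 - e) a e] and [e a (1 - e)]. *)
Let col a := a * e - k (tau a) * e.
Let row a := e * a - k (tau a) * e.

Let g0l : scalar g0 := g0P.1.

Let lN a : l (- a) = - l a.
Proof.
by apply/eqP; rewrite -addr_eq0 -lD addNr -[0](mul0r 0) -(rmorph0 k) lZ scale0r.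
Qed.

Let l0 : l 0 = 0. Proof. by rewrite -(mul0r 0) -(rmorph0 k) lZ scale0r. Qed.

Let tau0 : tau 0 = 0. Proof. by rewrite -(mul0r 0) -(rmorph0 k) tauZ mul0r. Qed.

Let y0_neq0 : y0 != 0.
Proof.
by apply/eqP => y00; have := g0y0; rewrite y00 functional0// => /eqP;
   rewrite eq_sym oner_eq0.
Qed.

Lemma col_e a : col a * e = col a.
Proof. by rewrite /col mulrBl -!mulrA ee. Qed.

Lemma e_col a : e * col a = 0.
Proof. by rewrite /col mulrBr mulrA eaeE mulrA -kC -mulrA ee subrr. Qed.

Lemma e_row a : e * row a = row a.
Proof. by rewrite /row mulrBr !mulrA ee -kC -mulrA ee. Qed.

Lemma row_e a : row a * e = 0.
Proof. by rewrite /row mulrBl eaeE -mulrA ee subrr. Qed.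

Lemma sandwich_col u b : u * e = u -> e * u = 0 -> u * b * u = k (tau (b * u)) * u.
Proof.
move=> ue eu; rewrite -{1}ue -{2}ue -!mulrA.
have := eaeE (b * u); rewrite -!mulrA => ->.
by rewrite mulrA -kC -mulrA ue.
Qed.

Lemma col_sq u : u * e = u -> e * u = 0 -> u * u = 0.
Proof. by move=> ue eu; rewrite -{1}ue -mulrA eu mulr0. Qed.

Lemma sandwich_row v b : e * v = v -> v * b * v = k (tau (v * b)) * v.
Proof.
move=> ev; rewrite -[in X in _ * X]ev -{1}ev !mulrA.
have := eaeE (v * b); rewrite !mulrA => ->.
by rewrite -mulrA ev.
Qed.

Lemma row_sq v : e * v = v -> v * e = 0 -> v * v = 0.
Proof. by move=> ev ve; rewrite -{2}ev mulrA ve mul0r. Qed.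

(** [l u] squares to zero, and at [y0] its square is [g0 (l u y0) *: l u y0]. *)
Lemma g0_col u : u * e = u -> e * u = 0 -> g0 (l u y0) = 0.
Proof.
move=> ue eu.
have [luu _] := l_extremal (col_sq ue eu) (fun b => sandwich_col b ue eu).
have := congr1 (fun b : 'B(X) => b y0) luu; rewrite boundedOp_mulE l_col//.
move=> /eqP; rewrite scaler_eq0 => /orP[/eqP//|/eqP->]; exact: functional0.
Qed.

Lemma row_y0 v : e * v = v -> v * e = 0 -> l v y0 = 0.
Proof.
move=> ev ve.
have [lvv _] := l_extremal (row_sq ev ve) (fun b => sandwich_row b ev).
have [r lvy] := l_row ev ve y0.
have := congr1 (fun b : 'B(X) => b y0) lvv.
rewrite boundedOp_mulE lvy linearZ/= lvy scalerA => /eqP.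
by rewrite scaler_eq0 (negPf y0_neq0) orbF mulf_eq0 orbb => /eqP->; rewrite scale0r.
Qed.

(** Obtained by evaluating [l u * l v * l u = tau (v * u) *: l u] at [y0] and cancelling [l u y0];
    if that vector vanishes, then [u = 0]. Here the preservation of the form is what counts. *)
Lemma row_col u v : u * e = u -> e * u = 0 -> e * v = v -> v * e = 0 ->
  l v (l u y0) = tau (v * u) *: y0.
Proof.
move=> ue eu ev ve.
have [_ lu] := l_extremal (col_sq ue eu) (fun b => sandwich_col b ue eu).
have [r lvu] := l_row ev ve (l u y0).
have := congr1 (fun b : 'B(X) => b y0) (lu v).
rewrite !boundedOp_mulE boundedOp_scaleE lvu linearZ/= => /eqP.
rewrite -subr_eq0 -scalerBl scaler_eq0 subr_eq0 => /orP[/eqP->//|/eqP luy].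
suff u0 : u = 0 by rewrite -lvu luy raddf0 u0 mulr0 tau0 scale0r.
by apply: l_inj; apply: boundedOp_ext => z; rewrite l_col// luy scaler0.
Qed.

(** The value depends on [a * e] only: it is [l u y0] at [u] in [(1 - e) S e], and [y0] at [e]. *)
Definition implement a : X := l (col a) y0 + tau a *: y0.
Local Notation U := implement.

Lemma colD a b : col (a + b) = col a + col b.
Proof. by rewrite /col tauD rmorphD !mulrDl opprD addrACA. Qed.

Lemma colZ r a : col (k r * a) = k r * col a.
Proof. by rewrite /col tauZ rmorphM mulrBr !mulrA. Qed.

Lemma implementD a b : U (a + b) = U a + U b.
Proof.
by rewrite /U colD lD boundedOp_addE tauD scalerDl addrACA.
Qed.

Lemma implementZ r a : U (k r * a) = r *: U a.
Proof. by rewrite /U colZ lZ boundedOp_scaleE tauZ scalerDr scalerA. Qed.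

Lemma implement0 : U 0 = 0.
Proof. by rewrite -(mul0r 0) -(rmorph0 k) implementZ scale0r. Qed.

Lemma implementN a : U (- a) = - U a.
Proof. by apply/eqP; rewrite -addr_eq0 -implementD addNr implement0. Qed.

Lemma implement_er a : U (a * e) = U a.
Proof. by rewrite /U /col tau_er -mulrA ee. Qed.

Lemma implement_e : U e = y0.
Proof. by rewrite /U /col tau_e rmorph1 mul1r ee subrr l0 add0r scale1r. Qed.

(** [g0] kills the first summand of [U a] and so recovers [tau a]; when this is zero, [l (col a)]
    vanishes too. *)
Lemma implement_eq0 a : U a = 0 -> a * e = 0.
Proof.
move=> Ua; have := congr1 g0 Ua; rewrite functionalD// functionalZ//.
rewrite g0_col ?col_e ?e_col// g0y0 mulr1 add0r functional0// => ta.
move: Ua; rewrite /U ta scale0r addr0 => lcy.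
have : col a = 0.
  by apply: l_inj; apply: boundedOp_ext => z;
     rewrite l_col ?col_e ?e_col// lcy scaler0.
by rewrite /col ta rmorph0 mul0r subr0.
Qed.

Let L c := forall a, l c (U a) = U (c * a).

Let L_col u : u * e = u -> e * u = 0 -> L u.
Proof.
move=> ue eu a; rewrite {1}/U linearD linearZ/= l_col//.
rewrite g0_col ?col_e ?e_col// scale0r add0r -[in RHS]implement_er.
have -> : u * a * e = k (tau a) * u.
  by rewrite -{1}ue -(mulrA u e) -(mulrA u) eaeE mulrA -kC -mulrA ue.
rewrite implementZ; congr (_ *: _).
have tu : tau u = 0 by rewrite -tau_el eu tau0.
by rewrite /U /col tu rmorph0 mul0r subr0 ue scale0r addr0.
Qed.

Let L_row v : e * v = v -> v * e = 0 -> L v.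
Proof.
move=> ev ve a; rewrite {1}/U linearD linearZ/= (row_y0 ev ve) scaler0 addr0.
rewrite row_col ?col_e ?e_col// -[in RHS]implement_er.
have -> : v * a * e = k (tau (v * a)) * e by rewrite -{1}ev -(mulrA e) eaeE.
rewrite implementZ implement_e; congr (_ *: _).
by rewrite /col mulrBr mulrA (kC _ e) (mulrA v e) ve mul0r subr0 tau_er.
Qed.

Let LD c d : L c -> L d -> L (c + d).
Proof. by move=> Lc Ld a; rewrite lD boundedOp_addE Lc Ld mulrDl implementD. Qed.

Let LZ r c : L c -> L (k r * c).
Proof. by move=> Lc a; rewrite lZ boundedOp_scaleE Lc -mulrA implementZ. Qed.

Let LB c d : L c -> L d -> L (c * d - d * c).
Proof.
move=> Lc Ld a; rewrite lB boundedOp_addE boundedOp_oppE !boundedOp_mulE.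
by rewrite !(Lc, Ld) mulrBl implementD implementN !mulrA.
Qed.

Let LN c : L c -> L (- c).
Proof. by move=> Lc a; rewrite lN boundedOp_oppE Lc mulNr implementN. Qed.

(** In operator terms [tau (c * a)] is the trace of [a * c]. With [p = col a] and [q = row c] the
    element equals [[p,q] + tau(c) p + tau(a) q], built from elements implemented by [U]. *)
Let L_trace0 a c : e * c = c -> L (a * c - k (tau (c * a)) * e).
Proof.
move=> ec; set p := col a; set q := row c.
have aE : a * e = p + k (tau a) * e by rewrite /p /col subrK.
have cE : c = q + k (tau c) * e by rewrite /q /row ec subrK.
have pe : p * e = p := col_e a; have ep : e * p = 0 := e_col a.
have eq : e * q = q := e_row c; have qe : q * e = 0 := row_e c.
have Lp : L p := L_col pe ep; have Lq : L q := L_row eq qe.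
clearbody p q.
have acE : a * c =
    p * q + k (tau c) * p + (k (tau a) * q + k (tau a) * k (tau c) * e).
  rewrite -[in LHS]ec mulrA aE [in LHS]cE mulrDl !mulrDr; congr (_ + _ + (_ + _)).
  - by rewrite mulrA -kC -mulrA pe.
  - by rewrite -mulrA eq.
  - by rewrite -!mulrA; congr (_ * _); rewrite mulrA -kC -mulrA ee.
have caE : k (tau (c * a)) * e = q * p + k (tau a) * k (tau c) * e.
  rewrite -eaeE mulrA ec -mulrA aE [in LHS]cE mulrDl !mulrDr.
  rewrite mulrA -kC -mulrA qe mulr0 addr0 -mulrA ep mulr0 add0r.
  congr (_ + _); rewrite [k (tau a) * k _]kC -!mulrA; congr (_ * _).
  by rewrite mulrA -kC -mulrA ee.
rewrite acE caE opprD addrA (addrA _ (k (tau a) * q)) addrAC.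
rewrite addrK -(addrA (p * q)) addrAC.
by apply: LD; [exact: LB|apply: LD; exact: LZ].
Qed.

Let sandwich c b d : e * c = c -> e * d = d -> c * b * d = k (tau (c * b)) * d.
Proof. by move=> ec ed; rewrite -ed -{1}ec -(mulrA e c) mulrA eaeE -mulrA. Qed.

(* [N = a c] is an extremal element on which [l] is implemented by [U], and the
   image of [l N] is the line through [U a = l N (U z)]. *)
Lemma implement_bracket b a : exists r, l b (U a) - U (b * a) = r *: U a.
Proof.
have [Ua0|Ua0] := eqVneq (U a) 0.
  exists 0; rewrite -[U (b * a)]implement_er -mulrA (implement_eq0 Ua0) Ua0.
  by rewrite linear0 mulr0 implement0 subrr scale0r.
have [c [z [ec ca cz]]] := tau_split a.
have cze d : c * d * e = k (tau (c * d)) * e by rewrite sandwich.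
have UczE x d : U (x * c * d) = tau (c * d) *: U x.
  by rewrite -implement_er -!mulrA (mulrA c) cze mulrA -kC -mulrA implementZ
    implement_er.
have LN0 : L (a * c).
  by have := L_trace0 a ec; rewrite ca rmorph0 mul0r subr0.
have [lN2 lN_ext] : l (a * c) * l (a * c) = 0 /\
    forall d, l (a * c) * l d * l (a * c) = tau (c * (d * a)) *: l (a * c).
  apply: l_extremal => [|d].
    by rewrite -mulrA [c * _]mulrA sandwich// ca rmorph0 mul0r mulr0.
  rewrite -!mulrA (mulrA d) (mulrA c (d * a)) sandwich//.
  by rewrite mulrA -kC -mulrA.
have [t tE] : exists t : 'B(X) -> F, extremal (l (a * c)) t.
  have /choice[t tE] : forall y : 'B(X), exists r,
      l (a * c) * y * l (a * c) = r *: l (a * c).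
    by move=> y; have [d <-] := l_surj y; exists (tau (c * (d * a))).
  by exists t.
have lNz : l (a * c) (U z) = U a by rewrite LN0 UczE cz scale1r.
have [|g _ lNE] := extremal_rank_one (y := U z) hF tE; first by rewrite lNz.
(* Both [(b a) c] and [a (c b)] need the same correction [tau (c * b * a)] times [e], which cancels
   in the difference. *)
have Lbr : L (b * (a * c) - (a * c) * b).
  have := LD (L_trace0 (b * a) ec) (LN (L_trace0 a (c := c * b) _)).
  rewrite [e * _]mulrA ec => /(_ erefl).
  by rewrite opprB addrA -[c * b * a]mulrA subrK !mulrA.
(* At [U z] the bracket reads [l b (U a) - g (l b (U z)) *: U a] on one side and
   [U (b * a) - tau (c * (b * z)) *: U a] on the other. *)
have := Lbr z; rewrite lB boundedOp_addE boundedOp_oppE !boundedOp_mulE lNz lNE.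
rewrite lNz mulrBl implementD implementN mulrA UczE cz scale1r -(mulrA (a * c)) UczE.
move/eqP; rewrite subr_eq => /eqP ->.
exists (- tau (c * (b * z)) + g (l b (U z))).
by rewrite addrAC (addrAC (U _)) subrr add0r scalerDl scaleNr.
Qed.

Lemma implement_mul b : exists r, forall a, l b (U a) = U (b * a) + r *: U a.
Proof.
have [|||||r rE] := @proportional_scalar F S X (fun r a => k r * a) U
    (fun a => l b (U a) - U (b * a)).
- exact: implementD.
- by move=> x y; rewrite mulrDr !implementD linearD opprD addrACA.
- exact: implementZ.
- move=> r x; rewrite mulrA -kC -mulrA !implementZ linearZ/=.
  by rewrite scalerBr.
- exact: implement_bracket.
by exists r => a; rewrite -rE addrC subrK.
Qed.

(* The range of [U] is invariant under all of ['B(X)], hence everything. *)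
Lemma implement_surj x : exists a, U a = x.
Proof.
(* For [l b] = x (x) g0 one has [l b (U e) = l b y0 = x], and the left side is
   [U (b * e) + r *: U e]. *)
have [b lb] := l_surj (rank_one g0P x); have [r lbU] := implement_mul b.
exists (b * e + k r * e); rewrite implementD implementZ -lbU lb implement_e.
by rewrite rank_oneE g0y0 scale1r.
Qed.

(** [phi b = l b - n b] turns into left multiplication by [b] under the surjective [U], so its
    identities can be checked on values of [U]. Injectivity comes from [faithful_e]. *)
Lemma lie_iso_standard : exists (phi : S -> 'B(X)) (n : S -> F),
  [/\ forall a, l a = phi a + n a *: (1 : 'B(X)),
      (forall r a b, phi (k r * a + b) = r *: phi a + phi b),
      bijective phi, phi 1 = 1 & {morph phi : a b / a * b}].
Proof.
have /choice[n nE] := implement_mul.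
pose phi b := l b - n b *: (1 : 'B(X)).
have phiE b a : phi b (U a) = U (b * a).
  by rewrite boundedOp_addE boundedOp_oppE boundedOp_scaleE boundedOp_oneE nE addrK.
have lE b : l b = phi b + n b *: (1 : 'B(X)) by rewrite subrK.
clearbody phi.
have ext (s t : 'B(X)) : (forall a, s (U a) = t (U a)) -> s = t.
  by move=> st; apply: boundedOp_ext => x; have [a <-] := implement_surj x.
have phi1 : phi 1 = 1 by apply: ext => a; rewrite phiE mul1r.
have phiP r a b : phi (k r * a + b) = r *: phi a + phi b.
  apply: ext => c; rewrite boundedOp_addE boundedOp_scaleE !phiE mulrDl.
  by rewrite -mulrA implementD implementZ.
have phi_inj a b : phi a = phi b -> a = b.
  move=> ab; apply/eqP; rewrite -subr_eq0; apply/eqP; apply: faithful_e => c.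
  apply: implement_eq0; rewrite mulrBl implementD implementN -!phiE ab.
  by rewrite subrr.
have phi_surj y : exists a, phi a = y.
  (* As [phi 1 = 1], adding [n a] times the unit to [a] restores the scalar part of [l a]. *)
  have [a la] := l_surj y; exists (k (n a) * 1 + a).
  by rewrite phiP phi1 -la lE addrC.
exists phi, n; split=> //.
- have [h hK] := choice phi_surj.
  by exists h => // a; apply: phi_inj; rewrite hK.
- by move=> a b; apply: ext => c; rewrite boundedOp_mulE !phiE mulrA.
Qed.

End Implementation.

(** * Rows and columns of a rank-one idempotent *)

Section ScalarOperators.
Context (F : numFieldType) (X : completeNormedModType F).

Definition scalar_op (r : F) : 'B(X) := r *: (1 : 'B(X)).

Lemma scalar_opE r (a : 'B(X)) : scalar_op r * a = r *: a.
Proof. by rewrite -boundedOp_scaleAl mul1r. Qed.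

Lemma scalar_opC r (a : 'B(X)) : scalar_op r * a = a * scalar_op r.
Proof. by rewrite scalar_opE -boundedOp_scaleAr mulr1. Qed.

Fact scalar_op_zmod_morphism : zmod_morphism scalar_op.
Proof. by move=> r s; rewrite /scalar_op scalerBl. Qed.

Fact scalar_op_monoid_morphism : monoid_morphism scalar_op.
Proof.
split; first exact: scale1r.
by move=> r s; rewrite scalar_opE scalerA.
Qed.

HB.instance Definition _ :=
  GRing.isZmodMorphism.Build F 'B(X) scalar_op scalar_op_zmod_morphism.
HB.instance Definition _ :=
  GRing.isMonoidMorphism.Build F 'B(X) scalar_op scalar_op_monoid_morphism.

Definition scalar_opc (r : F) : 'B(X)^c := scalar_op r.

Fact scalar_opc_monoid_morphism : monoid_morphism scalar_opc.
Proof.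
split; first exact: scale1r.
by move=> r s; apply: etrans (scalar_opC _ _); apply: (rmorphM scalar_op).
Qed.

HB.instance Definition _ :=
  GRing.isZmodMorphism.Build F 'B(X)^c scalar_opc scalar_op_zmod_morphism.
HB.instance Definition _ :=
  GRing.isMonoidMorphism.Build F 'B(X)^c scalar_opc scalar_opc_monoid_morphism.

End ScalarOperators.

(** * Lie isomorphisms in the presence of a biorthogonal pair *)

Section DualPair.
Context (F : numFieldType) (hF : real_or_complex F).
Context (X : completeNormedModType F).
Context (x0 x1 : X) (f0 f1 : X -> F).
Hypotheses (f0P : bounded_functional f0) (f1P : bounded_functional f1).
Hypotheses (f00 : f0 x0 = 1) (f01 : f0 x1 = 0).
Hypotheses (f10 : f1 x0 = 0) (f11 : f1 x1 = 1).
Context (l : {linear 'B(X) -> 'B(X)}).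
Hypothesis l_bij : bijective l.
Hypothesis lB : forall a b, l (lie_bracket a b) = lie_bracket (l a) (l b).
Implicit Types a b u v : 'B(X).

Let f0l : scalar f0 := f0P.1.

Definition corner_idem : 'B(X) := rank_one f0P x0.
Local Notation e := corner_idem.
Definition corner_coef a : F := f0 (a x0).
Local Notation tau := corner_coef.

Lemma corner_idemE z : e z = f0 z *: x0. Proof. by []. Qed.

Lemma corner_idem_sq : e * e = e.
Proof.
by apply: boundedOp_ext => z; rewrite boundedOp_mulE !corner_idemE
  functionalZ// f00 mulr1.
Qed.

Lemma corner_sandwich a : e * a * e = tau a *: e.
Proof.
apply: boundedOp_ext => z.
rewrite boundedOp_scaleE !boundedOp_mulE !corner_idemE linearZ/= functionalZ//.
by rewrite scalerA mulrC.
Qed.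

Lemma corner_coefD a b : tau (a + b) = tau a + tau b.
Proof. by rewrite /tau boundedOp_addE functionalD. Qed.

Lemma corner_coefZ r a : tau (r *: a) = r * tau a.
Proof. by rewrite /tau boundedOp_scaleE functionalZ. Qed.

Lemma corner_coef_el a : tau (e * a) = tau a.
Proof. by rewrite /tau boundedOp_mulE corner_idemE functionalZ// f00 mulr1. Qed.

Lemma corner_coef_er a : tau (a * e) = tau a.
Proof. by rewrite /tau boundedOp_mulE corner_idemE f00 scale1r. Qed.

Lemma corner_coef_e : tau e = 1.
Proof. by rewrite /tau corner_idemE f00 scale1r. Qed.

(** Serves [tau_split]: a nontrivial combination of [f0] and [f1] vanishes at [x]. *)
Lemma functional_kernel (x : X) :
  exists f : X -> F, [/\ bounded_functional f, f x = 0 & exists z, f z = 1].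
Proof.
have [f1x|f1x] := eqVneq (f1 x) 0; first by exists f1; split=> //; exists x1.
exists (fun z => 1 * f0 z + (- f0 x / f1 x) * f1 z); split.
- exact: bounded_functional_lin.
- by rewrite mul1r divfK// subrr.
- by exists x0; rewrite f00 f10 mulr0 addr0 mulr1.
Qed.

(** The counterpart of [functional_kernel] for the opposite ring, with a combination of [x0] and
    [x1]. *)
Lemma kernel_vector (f : X -> F) : bounded_functional f ->
  exists x, f x = 0 /\ exists2 g : X -> F, bounded_functional g & g x = 1.
Proof.
move=> [fl _]; have [fx1|fx1] := eqVneq (f x1) 0.
  by exists x1; split=> //; exists f1.
exists (x0 + (- f x0 / f x1) *: x1); split.
  by rewrite functionalD// functionalZ// divfK// subrr.
by exists f0 => //; rewrite functionalD// functionalZ// f00 f01 mulr0 addr0.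
Qed.

Lemma lie_standard_pos (y0 : X) (g0 : X -> F) :
  bounded_functional g0 -> g0 y0 = 1 ->
  (forall u, u * e = u -> e * u = 0 -> forall z, l u z = g0 z *: l u y0) ->
  (forall v, e * v = v -> v * e = 0 -> forall z, exists r, l v z = r *: y0) ->
  exists2 phi, algebra_isomorphism phi &
    exists n : 'B(X) -> F, forall a, l a = phi a + n a *: (1 : 'B(X)).
Proof.
move=> g0P g0y0 lcol lrow; have [li lK liK] := l_bij.
have [||||||||||||||||||||phi [n [lE phiP phi_bij phi1 phiM]]] :=
  @lie_iso_standard F hF X 'B(X) (@scalar_op F X) e tau l y0 g0.
- exact: scalar_opC.
- exact: corner_idem_sq.
- by move=> a; rewrite scalar_opE corner_sandwich.
- exact: corner_coefD.
- by move=> r a; rewrite scalar_opE corner_coefZ.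
- exact: corner_coef_el.
- exact: corner_coef_er.
- exact: corner_coef_e.
- exact: linearD.
- by move=> r a; rewrite scalar_opE linearZ.
- by move=> a la; apply: (can_inj lK); rewrite la linear0.
- by move=> y; exists (li y).
- exact: lB.
- move=> a t aa aba; apply: (extremal_lie hF l_bij lB); split=> // b.
  by rewrite aba scalar_opE.
- exact: g0P.
- exact: g0y0.
- exact: lcol.
- exact: lrow.
- move=> a; have [f [fP fax [w fw]]] := functional_kernel (a x0).
  exists (rank_one fP x0), (rank_one f0P w); split.
  + apply: boundedOp_ext => z.
    by rewrite boundedOp_mulE corner_idemE rank_oneE functionalZ// f00 mulr1.
  + by rewrite /tau boundedOp_mulE rank_oneE fax scale0r functional0.
  + by rewrite /tau boundedOp_mulE !rank_oneE f00 scale1r fw scale1r.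
(* Test [b] on z (x) f0, which sends [x0] to [z]. *)
- move=> b be; apply: boundedOp_ext => z.
  have := congr1 (fun a : 'B(X) => a x0) (be (rank_one f0P z)).
  by rewrite !boundedOp_mulE corner_idemE f00 scale1r rank_oneE f00 scale1r.
exists phi; last by exists n.
by split=> // r a b; rewrite -scalar_opE phiP.
Qed.

(** Passing to the opposite ring negates brackets, so [- l] respects them there; columns and rows
    change places, and a multiplicative [phi] becomes an anti-isomorphism. *)
Lemma lie_standard_neg (y0 : X) (g0 : X -> F) :
  bounded_functional g0 -> g0 y0 = 1 ->
  (forall v, e * v = v -> v * e = 0 -> forall z, l v z = g0 z *: l v y0) ->
  (forall u, u * e = u -> e * u = 0 -> forall z, exists r, l u z = r *: y0) ->
  exists2 phi, algebra_antiisomorphism phi &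
    exists n : 'B(X) -> F, forall a, l a = - phi a + n a *: (1 : 'B(X)).
Proof.
move=> g0P g0y0 lcol lrow; have [li lK liK] := l_bij.
have [||||||||||||||||||||phi [n [lE phiP phi_bij phi1 phiM]]] :=
  @lie_iso_standard F hF X 'B(X)^c (@scalar_opc F X) e tau (fun a => - l a) y0 g0.
- by move=> r a; apply/esym/scalar_opC.
- exact: corner_idem_sq.
- move=> a; apply: etrans (scalar_opC _ _); rewrite scalar_opE.
  by rewrite -corner_sandwich; apply: mulrA.
- exact: corner_coefD.
- by move=> r a; rewrite -corner_coefZ -scalar_opE scalar_opC.
- exact: corner_coef_er.
- exact: corner_coef_el.
- exact: corner_coef_e.
- by move=> a b; rewrite linearD opprD.
- move=> r a; rewrite scalerN -linearZ -scalar_opE scalar_opC; by [].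
- by move=> a /eqP; rewrite oppr_eq0 => /eqP la;
     apply: (can_inj lK); rewrite la linear0.
- by move=> y; exists (li (- y)); rewrite liK opprK.
- by move=> a b; rewrite !mulrNN -[RHS]opprB; congr (- _); exact: (lB b a).
- move=> a t aa aba.
  have [|la2 laba] := @extremal_lie F hF X l a t l_bij lB.
    split=> // b; rewrite -scalar_opE scalar_opC -mulrA; exact: aba.
  by split=> [|b]; rewrite mulrNN ?mulrN ?laba ?scalerN.
- exact: g0P.
- exact: g0y0.
- by move=> v ve ev z; rewrite !boundedOp_oppE lcol// scalerN.
- by move=> u eu ue z; have [r lu] := lrow _ eu ue z; exists (- r);
     rewrite boundedOp_oppE lu scaleNr.
(* Products are reversed, so [c] = x (x) f0 with [f0 (a x) = 0], and [z] = x0 (x) g with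
   [g x = 1]. *)
- move=> a; have [x [fax [g gP gx]]] :=
    kernel_vector (bounded_functional_comp a f0P).
  exists (rank_one f0P x), (rank_one gP x0); split.
  + apply: boundedOp_ext => z.
    change (rank_one f0P x (e z) = rank_one f0P x z).
    by rewrite !rank_oneE functionalZ// f00 mulr1.
  + change (f0 (a (rank_one f0P x x0)) = 0).
    by rewrite rank_oneE f00 scale1r.
  + change (f0 (rank_one gP x0 (rank_one f0P x x0)) = 1).
    by rewrite !rank_oneE f00 scale1r gx scale1r.
- move=> b be; apply: boundedOp_ext => z; apply: contrapT => /eqP bz.
  have [g gP gbz] := exists_functional hF bz.
  have : e (rank_one gP x0 (b z)) = 0.
    exact: (congr1 (fun a : 'B(X) => a z) (be (rank_one gP x0))).
  rewrite !rank_oneE gbz scale1r f00 scale1r => x00.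
  by have := f00; rewrite x00 functional0// => /eqP; rewrite eq_sym oner_eq0.
exists phi; last first.
  exists (fun a => - n a) => a.
  by apply: oppr_inj; rewrite opprD opprK -scaleNr opprK lE.
split=> //; last by split=> // a b; exact: (phiM b a).
by move=> r a b; rewrite -phiP -scalar_opE scalar_opC.
Qed.


(** Pointwise forms of membership in [(1 - e) B e] and [e B (1 - e)], suited to rank-one
    computations. *)
Let is_col u := (forall z, u z = f0 z *: u x0) /\ f0 (u x0) = 0.
Let is_row v := (forall z, v z = f0 (v z) *: x0) /\ v x0 = 0.

Let is_colP u : u * e = u -> e * u = 0 -> is_col u.
Proof.
move=> ue eu; split=> [z|].
  by rewrite -[in LHS]ue boundedOp_mulE corner_idemE linearZ.
have := congr1 tau eu; rewrite /tau boundedOp_mulE corner_idemE functionalZ//.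
by rewrite f00 mulr1 => ->; exact: functional0.
Qed.

Let is_rowP v : e * v = v -> v * e = 0 -> is_row v.
Proof.
move=> ev ve; split=> [z|]; first by rewrite -[in LHS]ev boundedOp_mulE corner_idemE.
have := congr1 (fun b : 'B(X) => b x0) ve.
by rewrite boundedOp_mulE corner_idemE f00 scale1r.
Qed.

Let is_colDZ r u u' : is_col u -> is_col u' -> is_col (u + r *: u').
Proof.
move=> [uE u0] [uE' u0']; split=> [z|]; rewrite !boundedOp_addE boundedOp_scaleE.
  by rewrite uE uE' boundedOp_scaleE scalerDr !scalerA mulrC.
by rewrite functionalD// functionalZ// u0 u0' mulr0 addr0.
Qed.

Let is_rowDZ r v v' : is_row v -> is_row v' -> is_row (v + r *: v').
Proof.
move=> [vE v0] [vE' v0']; split=> [z|]; rewrite !boundedOp_addE boundedOp_scaleE.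
  by rewrite functionalD// functionalZ// scalerDl -scalerA -vE -vE'.
by rewrite v0 v0' scaler0 addr0.
Qed.

Let col_extremal u : is_col u -> extremal u (fun b => tau (b * u)).
Proof.
move=> [uE u0]; split=> [|b]; apply: boundedOp_ext => z.
  by rewrite boundedOp_mulE uE (uE z) functionalZ// u0 mulr0 scale0r.
rewrite boundedOp_scaleE !boundedOp_mulE uE (uE z) linearZ/= functionalZ//.
by rewrite mulrC -scalerA.
Qed.

Let row_extremal v : is_row v -> extremal v (fun b => tau (v * b)).
Proof.
move=> [vE v0]; split=> [|b]; apply: boundedOp_ext => z.
  by rewrite boundedOp_mulE (vE z) linearZ/= v0 scaler0.
rewrite boundedOp_scaleE !boundedOp_mulE (vE z) !linearZ/= [v (b x0)]vE.
by rewrite !scalerA mulrC.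
Qed.

(** A column and a row with pairing [1]; their images are the base points of the two dichotomies. *)
Let u0 := rank_one f0P x1.
Let v0 := rank_one f1P x0.

Let col_u0 : is_col u0.
Proof.
by split=> [z|]; rewrite !rank_oneE f00 scale1r.
Qed.

Let row_v0 : is_row v0.
Proof.
by split=> [z|]; rewrite !rank_oneE ?functionalZ ?f00 ?mulr1// f10 scale0r.
Qed.

Let tau_v0u0 : tau (v0 * u0) = 1.
Proof. by rewrite /tau boundedOp_mulE !rank_oneE f00 scale1r f11 scale1r. Qed.

(** Pairing [v] with the column (z - f0(z) x0) (x) f0 yields [f0 (v z)]. *)
Let row_eq0 v : is_row v -> (forall u, is_col u -> tau (v * u) = 0) -> v = 0.
Proof.
move=> [vE vx0] vu; apply: boundedOp_ext => z; rewrite vE.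
have col_w : is_col (rank_one f0P (z - f0 z *: x0)).
  split=> [t|]; rewrite !rank_oneE f00 scale1r//.
  by rewrite -scaleNr functionalD// functionalZ// f00 mulr1 subrr.
have := vu _ col_w; rewrite /tau boundedOp_mulE rank_oneE f00 scale1r.
rewrite linearB linearZ/= vx0 scaler0 subr0 => ->; exact: scale0r.
Qed.

(** If [g (u x0) = 1], pairing [u] with the row x0 (x) (g - g(x0) f0) yields [1]. *)
Let col_eq0 u : is_col u -> (forall v, is_row v -> tau (v * u) = 0) -> u = 0.
Proof.
move=> [uE fu] vu; apply: boundedOp_ext => z; rewrite uE.
suff -> : u x0 = 0 by exact: scaler0.
apply: contrapT => /eqP ux0; have [g gP gu] := exists_functional hF ux0.
have gP' := bounded_functional_lin 1 (- g x0) gP f0P.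
have row_g : is_row (rank_one gP' x0).
  split=> [t|]; rewrite !rank_oneE; first by rewrite functionalZ// f00 mulr1.
  by rewrite f00 mulr1 mul1r subrr scale0r.
have := vu _ row_g; rewrite /tau boundedOp_mulE !rank_oneE.
rewrite gu fu mulr0 addr0 mulr1 scale1r f00 => /eqP; by rewrite oner_eq0.
Qed.

Let l_eq0 a : l a = 0 -> a = 0.
Proof. by have [li lK _] := l_bij => la; apply: (can_inj lK); rewrite la linear0. Qed.

Let lDZ a r b x : l (a + r *: b) x = l a x + r *: l b x.
Proof. by rewrite linearD linearZ. Qed.

Let l_col u : is_col u ->
  forall b, l u * l b * l u = tau (b * u) *: l u.
Proof. by move=> /col_extremal cu; exact: (extremal_lie hF l_bij lB cu).2. Qed.

Let l_row v : is_row v ->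
  forall b, l v * l b * l v = tau (v * b) *: l v.
Proof. by move=> /row_extremal rv; exact: (extremal_lie hF l_bij lB rv).2. Qed.

Let l_rank_one a t y : extremal a t -> l a y != 0 ->
  exists2 g, bounded_functional g & forall z, l a z = g z *: l a y.
Proof.
move=> at_; have [laa laba] := extremal_lie hF l_bij lB at_.
have [li _ liK] := l_bij.
apply: (@extremal_rank_one F hF X (l a) (t \o li)); split=> // b.
by rewrite -[b in LHS]liK laba.
Qed.

Lemma lie_standard :
  (exists2 phi, algebra_isomorphism phi &
    exists n : 'B(X) -> F, forall a, l a = phi a + n a *: (1 : 'B(X))) \/
  (exists2 phi, algebra_antiisomorphism phi &
    exists n : 'B(X) -> F, forall a, l a = - phi a + n a *: (1 : 'B(X))).
Proof.
(* This relation gives vectors with [l v0 y1 = y0] and [l u0 y0 = y1], so [l u0] = y1 (x) g0 and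
   [l v0] = y0 (x) g1. *)
have sts : l u0 * l v0 * l u0 = l u0 by rewrite l_col// tau_v0u0 scale1r.
have /boundedOp_neq0[z1 sz1] : l u0 != 0.
  apply/eqP => /l_eq0 u00; have := tau_v0u0; rewrite u00 mulr0 /tau.
  by rewrite [X in f0 X]/(0 : X) functional0// => /eqP; rewrite eq_sym oner_eq0.
pose y1 := l u0 z1; pose y0 := l v0 y1.
have sy0 : l u0 y0 = y1.
  by have := congr1 (fun a : 'B(X) => a z1) sts; rewrite !boundedOp_mulE.
have y1_neq0 : y1 != 0 by [].
have y0_neq0 : y0 != 0.
  by apply: contraNneq y1_neq0 => y00; rewrite -sy0 y00 linear0.
have [|g0 g0P sE] := l_rank_one (y := y0) (col_extremal col_u0).
  by rewrite sy0.
have [|g1 g1P tE] := l_rank_one (y := y1) (row_extremal row_v0); first by [].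
rewrite sy0 in sE; rewrite -/y0 in tE.
have g0y0 : g0 y0 = 1.
  apply/eqP; have := sE y0; rewrite sy0 => /eqP.
  rewrite -subr_eq0 -{1}[y1]scale1r -scalerBl scaler_eq0 (negPf y1_neq0) orbF.
  by rewrite subr_eq0 eq_sym.
have g1y1 : g1 y1 = 1.
  apply/eqP; have := tE y1; rewrite -/y0 => /eqP.
  rewrite -subr_eq0 -{1}[y0]scale1r -scalerBl scaler_eq0 (negPf y0_neq0) orbF.
  by rewrite subr_eq0 eq_sym.
have rowT : (forall s, (exists2 v, is_row v & s = l v) ->
      forall z, s z = g1 z *: s y1) \/
    (forall s, (exists2 v, is_row v & s = l v) -> forall z, exists r, s z = r *: y0).
  apply: (@rank_le1_dichotomy F X _ (l v0) g1 y1).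
  - move=> _ _ [v rv ->] [v' rv' ->].
    by exists (v + 1 *: v'); [exact: is_rowDZ|rewrite scale1r linearD].
  - move=> _ [v rv ->] z lvz.
    by have [g _ gE] := l_rank_one (row_extremal rv) lvz; exists g.
  - by exists v0.
  - by [].
  - exact: g1P.1.
  - exact: tE.
have colT : (forall s, (exists2 u, is_col u & s = l u) ->
      forall z, s z = g0 z *: s y0) \/
    (forall s, (exists2 u, is_col u & s = l u) -> forall z, exists r, s z = r *: y1).
  rewrite -sy0; apply: (@rank_le1_dichotomy F X _ (l u0) g0 y0).
  - move=> _ _ [u cu ->] [u' cu' ->].
    by exists (u + 1 *: u'); [exact: is_colDZ|rewrite scale1r linearD].
  - move=> _ [u cu ->] z luz.
    by have [g _ gE] := l_rank_one (col_extremal cu) luz; exists g.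
  - by exists u0.
  - by rewrite sy0.
  - exact: g0P.1.
  - by move=> z; rewrite sy0.
have pos (colF : forall u, is_col u -> forall z, l u z = g0 z *: l u y0)
    (rowV : forall v, is_row v -> forall z, exists r, l v z = r *: y0) :
    exists2 phi, algebra_isomorphism phi &
      exists n : 'B(X) -> F, forall a, l a = phi a + n a *: (1 : 'B(X)).
  apply: (lie_standard_pos g0P g0y0) => [u ue eu|v ev ve].
    exact: colF (is_colP ue eu).
  exact: rowV (is_rowP ev ve).
have [colF|colV] := colT; have [rowF|rowV] := rowT.
(* Both images share a functional. After subtracting the multiple of [v0] that makes [g0 (l v y1)]
   vanish, a row pairs to zero with all columns; hence every row is a multiple of [v0], and [y0] is
   shared as well. *)
- left; apply: pos => [u cu|v rv]; first by apply: colF; exists u.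
  pose r := g0 (l v y1).
  suff vE : v + (- r) *: v0 = 0.
    have -> : v = r *: v0.
      by apply/eqP; rewrite -subr_eq0 -scaleNr vE.
    by move=> z; exists (r * g1 z); rewrite linearZ boundedOp_scaleE tE scalerA.
  have rv' := is_rowDZ (- r) rv row_v0; apply: row_eq0 => // u cu.
  have [->|u_neq0] := eqVneq u 0.
    by rewrite mulr0 /tau [X in f0 X]/(0 : X) functional0.
  have luC z : l u z = g0 z *: l u y0 by apply: colF; exists u.
  have lvC z : l (v + (- r) *: v0) z = g1 z *: l (v + (- r) *: v0) y1.
    by apply: rowF; exists (v + (- r) *: v0).
  have : tau ((v + (- r) *: v0) * u) *: l u = 0.
    rewrite -l_col//; apply: boundedOp_ext => z; rewrite !boundedOp_mulE luC lvC.
    rewrite functionalZ; last exact: g0P.1.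
    rewrite lDZ -/y0 functionalD; last exact: g0P.1.
    rewrite functionalZ; last exact: g0P.1.
    by rewrite g0y0 mulr1 subrr mulr0 scale0r.
  move/eqP; rewrite scaler_eq0 => /orP[/eqP//|/eqP/l_eq0 u00].
  by rewrite u00 eqxx in u_neq0.
- left; apply: pos => [u cu|v rv]; first by apply: colF; exists u.
  by apply: rowV; exists v.
(* The roles are exchanged: rows keep the functional [g1], columns keep the vector [y1]. *)
- right; apply: (lie_standard_neg g1P g1y1) => [v ev ve|u ue eu].
    by apply: rowF; exists v => //; exact: is_rowP.
  by apply: colV; exists u => //; exact: is_colP.
(* Both images share a vector. Dually to the first case, nondegeneracy of the pairing makes every
   column a multiple of [u0], so [g0] is shared. *)
- left; apply: pos => [u cu|v rv]; last by apply: rowV; exists v.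
  have [|r luy] := colV (l u) _ y0; first by exists u.
  suff uE : u + (- r) *: u0 = 0.
    have -> : u = r *: u0.
      by apply/eqP; rewrite -subr_eq0 -scaleNr uE.
    by move=> z; rewrite linearZ !boundedOp_scaleE sy0 sE !scalerA mulrC.
  have cu' := is_colDZ (- r) cu col_u0; apply: col_eq0 => // v rv.
  have [->|v_neq0] := eqVneq v 0.
    by rewrite mul0r /tau [X in f0 X]/(0 : X) functional0.
  have : tau (v * (u + (- r) *: u0)) *: l v = 0.
    rewrite -l_row//; apply: boundedOp_ext => z; rewrite !boundedOp_mulE.
    have [|d ->] := rowV (l v) _ z; first by exists v.
    rewrite linearZ/= lDZ luy sy0 scaleNr subrr scaler0.
    by rewrite linear0.
  move/eqP; rewrite scaler_eq0 => /orP[/eqP//|/eqP/l_eq0 v00].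
  by rewrite v00 eqxx in v_neq0.
Qed.

End DualPair.

(** * Biorthogonal pairs, spaces of dimension at most one, and the conclusion *)

Lemma dual_pair (F : numFieldType) (X : completeNormedModType F) (x0 y : X) :
  real_or_complex F -> x0 != 0 -> (forall r, y != r *: x0) ->
  exists (x1 : X) (f0 f1 : X -> F),
    [/\ bounded_functional f0, bounded_functional f1,
        f0 x0 = 1 /\ f0 x1 = 0 & f1 x0 = 0 /\ f1 x1 = 1].
Proof.
move=> hF x0_neq0 yP; have [f fP fx0] := exists_functional hF x0_neq0.
(* Biorthogonalization: [y] is corrected along [x0] to lie in the kernel of [f], and below [g] is
   corrected along [f] to vanish at [x0]. *)
pose x1 := y + (- f y) *: x0.
have fx1 : f x1 = 0.
  by rewrite functionalD ?functionalZ ?fx0 ?mulr1 ?subrr//; exact: fP.1.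
have x1_neq0 : x1 != 0 by rewrite /x1 scaleNr subr_eq0 yP.
have [g gP gx1] := exists_functional hF x1_neq0.
exists x1, f, (fun z => 1 * g z + (- g x0) * f z); split=> //.
- exact: bounded_functional_lin.
- by rewrite fx0 fx1 gx1 mul1r !mulr1 mulr0 subrr addr0.
Qed.

Lemma boundedOp_comm_of_line (F : numFieldType) (X : completeNormedModType F) :
  (forall x y : X, x != 0 -> exists r, y = r *: x) ->
  forall a b : 'B(X), a * b = b * a.
Proof.
move=> line a b; apply: boundedOp_ext => x; rewrite !boundedOp_mulE.
have [->|x0] := eqVneq x 0; first by rewrite !linear0.
have [r ax] := line x (a x) x0; have [s bx] := line x (b x) x0.
by rewrite ax bx !linearZ/= ax bx !scalerA mulrC.
Qed.

Lemma lie_bracket_central (A : pzRingType) (a b z w : A) :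
  ring_center A z -> ring_center A w ->
  lie_bracket (a + z) (b + w) = lie_bracket a b.
Proof.
move=> zC wC; rewrite /lie_bracket mulrDr (mulrDl b) wC opprD addrACA subrr addr0.
by rewrite mulrDl mulrDr zC opprD addrACA subrr addr0.
Qed.

Unset Implicit Arguments.
Set Strict Implicit.

Theorem corollary4p10 (F : numFieldType) (hF : real_or_complex F)
    (X : completeNormedModType F) (l : 'B(X) -> 'B(X)) :
  lie_isomorphism l ->
  exists m n : 'B(X) -> 'B(X),
    [/\ forall a, l a = m a + n a,
        algebra_isomorphism m \/
          (exists2 phi : 'B(X) -> 'B(X),
             algebra_antiisomorphism phi & forall a, m a = - phi a),
        linear n,
        forall a, ring_center 'B(X) (n a)
      & forall a b, n (lie_bracket a b) = 0].
Proof.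
move=> [l_lin l_bij lB].
have [[x0 [y [x0_neq0 yP]]]|line] :=
  pselect (exists x0 y : X, x0 != 0 /\ forall r, y != r *: x0); last first.
  have comm : forall a b : 'B(X), a * b = b * a.
    apply: boundedOp_comm_of_line => x y x0; apply: contrapT => h.
    apply: line; exists x, y; split=> // r; apply/eqP => yr.
    by apply: h; exists r.
  (* In dimension at most one the algebra is commutative: everything is central and all brackets
     vanish. *)
  exists id, (fun a => l a - a); split.
  - by move=> a; rewrite addrC subrK.
  - by left; split=> //; exists id.
  - by move=> r a b; rewrite l_lin scalerBr opprD addrACA.
  - by move=> a b; apply: comm.
  - by move=> a b; rewrite lB /lie_bracket !(comm b) !(comm (l b)) !subrr.
pose L : {linear 'B(X) -> 'B(X)} :=
  HB.pack l (GRing.isLinear.Build F 'B(X) 'B(X) *:%R l l_lin).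
have [x1 [f0 [f1 [f0P f1P [f00 f01] [f10 f11]]]]] := dual_pair hF x0_neq0 yP.
have := @lie_standard F hF X x0 x1 f0 f1 f0P f1P f00 f01 f10 f11 L l_bij lB.
(* With [l - m] as the central part, linearity and vanishing on brackets follow from those of [l]
   and [m]; the scalars [n] supply centrality. *)
have std (m : 'B(X) -> 'B(X)) (n : 'B(X) -> F) :
    (forall a, l a = m a + n a *: (1 : 'B(X))) -> linear m ->
    (forall a b, m (lie_bracket a b) = lie_bracket (m a) (m b)) ->
    [/\ forall a, l a = m a + (l a - m a), linear (fun a => l a - m a),
        forall a, ring_center 'B(X) (l a - m a)
      & forall a b, l (lie_bracket a b) - m (lie_bracket a b) = 0].
  move=> lE m_lin mB; split.
  - by move=> a; rewrite addrC subrK.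
  - by move=> r a b; rewrite l_lin m_lin scalerBr opprD addrACA.
  - by move=> a b; rewrite lE addrAC subrr add0r; apply: scalar_opC.
  - move=> a b; rewrite lB mB !lE lie_bracket_central ?subrr// => c;
      exact: scalar_opC.
have linB (f : 'B(X) -> 'B(X)) a b : linear f -> f (a - b) = f a - f b.
  by move=> fl; rewrite addrC -scaleN1r fl scaleN1r addrC.
case=> -[phi [phi_lin phi_bij phiM] [n lE]].
  have [|lE' n_lin nC nB] := std phi n lE phi_lin.
    by move=> a b; rewrite /lie_bracket linB// !phiM.2.
  by exists phi, (fun a => l a - phi a); split=> //; left.
have [||lE' n_lin nC nB] := std (fun a => - phi a) n lE.
- by move=> r a b; rewrite phi_lin opprD scalerN.
(* The reversal of products and the sign each negate a bracket, so [- phi] respects it. *)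
- move=> a b; rewrite /lie_bracket !mulrNN.
  rewrite linB// opprB.
  by congr (_ - _); [exact: (phiM.2 b a)|exact: (phiM.2 a b)].
by exists (fun a => - phi a), (fun a => l a - - phi a); split=> //; right; exists phi.
Qed.
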